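(* Let $Y$ be a real vector space, $A\subseteq Y$ nonempty and $k\in Y\setminus\{0\}$. Consider a function $\varphi:Y\to\overline{\mathbb{R}}_\nu$ with $\operatorname{dom}\varphi=A+\mathbb{R}k$. If $$\forall y\in Y\ \forall t\in\mathbb{R}:\quad\varphi(y)\le t\iff y\in A+tk,\qquad( * )$$ then $$\varphi(y)=\inf\{t\in\mathbb{R}\mid y\in A+tk\}\quad\text{for all } y\in Y.$$ Moreover, $( * )$ is equivalent to $$\operatorname{epi}\varphi=\{(y,t)\in Y\times\mathbb{R}\mid y\in A+tk\}.$$
   Context: $\overline{\mathbb{R}}_\nu:=\overline{\mathbb{R}}\cup\{\nu\}$, where $\overline{\mathbb{R}}=\mathbb{R}\cup\{-\infty,+\infty\}$ and $\nu\notin\overline{\mathbb{R}}$ is a symbol used as function value outside the domain; $\nu$ is not comparable with real numbers (so $\nu\le t$ is false for $t\in\mathbb{R}$). Convention: $\inf\emptyset=\nu$; the infimum of a set of reals unbounded below is $-\infty$. For $\varphi:Y\to\overline{\mathbb{R}}_\nu$, the effective domain is $\operatorname{dom}\varphi=\{y\in Y\mid\varphi(y)\in\overline{\mathbb{R}}\}$ (i.e. $\varphi(y)\ne\nu$), and $\operatorname{epi}\varphi=\{(y,t)\in Y\times\mathbb{R}\mid\varphi(y)\le t\}$. *)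

(* Defs.v *)
From HB Require Import structures.
From mathcomp Require Import all_boot all_order all_algebra.
From mathcomp Require Import boolp classical_sets reals constructive_ereal ereal.

Set Implicit Arguments.
Unset Strict Implicit.
Unset Printing Implicit Defensive.
Import Order.TTheory GRing.Theory Num.Theory.

Local Open Scope classical_set_scope.
Local Open Scope ring_scope.

(* The extended reals with one extra value nu, taken outside the effective
   domain: [Some x] is the extended real x and [None] is nu. *)
Definition erealnu (R : realType) : Type := option (\bar R).

Definition nu {R : realType} : erealnu R := None.

(* nu is not comparable with real numbers, so nu <= t is false. *)
Definition lenu (R : realType) (u : erealnu R) (t : R) : bool :=
  if u is Some x then (x <= t%:E)%E else false.

(* Infimum with the convention inf set0 = nu (and not +oo, as for [ereal_inf]);
   for nonempty S unbounded below, [ereal_inf] gives -oo. *)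
Definition infnu (R : realType) (S : set R) : erealnu R :=
  if `[< S !=set0 >] then Some (ereal_inf (EFin @` S)) else nu.

Definition dom (R : realType) (Y : Type) (phi : Y -> erealnu R) : set Y :=
  [set y | exists x : \bar R, phi y = Some x].

Definition epi (R : realType) (Y : Type) (phi : Y -> erealnu R) : set (Y * R) :=
  [set p | lenu (phi p.1) p.2].

Definition translate (R : realType) (Y : lmodType R)
    (A : set Y) (v : Y) : set Y := [set a + v | a in A].

Definition sum_line (R : realType) (Y : lmodType R)
    (A : set Y) (k : Y) : set Y :=
  [set a + t *: k | a in A & t in [set: R]].

(* Main.v *)
Require Import Defs.
From HB Require Import structures.
From mathcomp Require Import all_boot all_order all_algebra.
From mathcomp Require Import boolp classical_sets reals constructive_ereal ereal.
Import Order.TTheory GRing.Theory Num.Theory.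
Local Open Scope classical_set_scope.
Local Open Scope ring_scope.

(** The condition on [phi] says that the real upper bounds of [phi y] are exactly
    the [t] with [y] in [A + t k], and an extended real is the infimum of its
    real upper bounds ([ereal_inf_real_ubounds]). What remains is to match the
    value nu with the convention inf set0 = nu: a value nu has no real upper
    bound, and a value other than nu has one, because then [y] lies in
    [dom phi = A + R k]. This is also what excludes the value +oo, whose set of
    real upper bounds is empty too. The reformulation with the epigraph is
    extensionality of sets of pairs. *)

(** The bound [x] is attained when it is real; for [x = -oo] every real is an
    upper bound, and for [x = +oo] none is, in agreement with the convention of
    [ereal_inf] that the infimum of the empty set is +oo. *)
Lemma ereal_inf_real_ubounds (R : realType) (x : \bar R) :
  ereal_inf (EFin @` [set t : R | (x <= t%:E)%E]) = x.
Proof.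
apply/eqP; rewrite eq_le; apply/andP; split; last first.
  by apply: le_ereal_inf_tmp => _ [t xt <-].
case: x => [r| |].
- by apply: ereal_inf_lbound; exists r => /=.
- exact: leey.
- rewrite leeNy_eq; apply/eqP/eq_ninfty => t.
  by apply: ereal_inf_lbound; exists t => //=; rewrite leNye.
Qed.

Theorem proposition1 (R : realType) (Y : lmodType R) (A : set Y) (k : Y)
    (phi : Y -> erealnu R)
    (A_nonempty : A !=set0) (k_neq0 : k <> 0)
    (dom_phi : dom phi = sum_line A k) :
  ((forall (y : Y) (t : R), lenu (phi y) t <-> translate A (t *: k) y) ->
     forall y : Y, phi y = infnu [set t : R | translate A (t *: k) y]) /\
  ((forall (y : Y) (t : R), lenu (phi y) t <-> translate A (t *: k) y) <->
     epi phi = [set p : Y * R | translate A (p.2 *: k) p.1]).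
Proof.
split; last first.
  split=> [phiP | epiE y t].
    by apply/seteqP; split=> -[y t] /= /phiP.
  by move/seteqP: epiE => [sub sup]; split; [exact: (sub (y, t))|exact: (sup (y, t))].
move=> phiP y.
have -> : [set t : R | translate A (t *: k) y] = [set t | lenu (phi y) t].
  by apply/seteqP; split=> t /= /phiP.
rewrite /infnu; case: asboolP => [[t /=]|no_ubound].
  by case: (phi y) => [x|] //= _; rewrite ereal_inf_real_ubounds.
case phiy: (phi y) => [x|//].
have : dom phi y by exists x.
rewrite dom_phi => -[a Aa [t _ y_eq]].
by case: no_ubound; exists t; apply/phiP; exists a.
Qed.
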